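(* Let $\Gamma$ be a finite tight program (rules may contain aggregate expressions in their bodies). An interpretation $\mathcal I$ is a stable model of $\Gamma$ if and only if $\mathcal I$ is contained in the vocabulary of $\Gamma$ and $\mathcal I$ satisfies the completion of $\Gamma$.
   Context: Syntax. Fix pairwise disjoint sets of numerals, symbolic constants, variables, operation names (each with an arity) and aggregate names, not containing the special symbols $\mathit{inf}$, $\mathit{sup}$, $\mathit{not}$, $..$, the relation symbols $=,\neq,<,>,\le,\ge$, or logical symbols. There is a fixed bijection $n\mapsto\overline n$ from $\mathbb Z$ onto the numerals. Each $n$-ary operation name $\mathit{op}$ has a function $\widehat{\mathit{op}}$ from a subset of $\mathbb Z^n$ to $\mathbb Z$; each aggregate name $\alpha$ has a function $\widehat\alpha$ mapping every set of non-empty tuples of precomputed terms to a precomputed term. Terms: numerals, symbolic constants, variables, $\mathit{inf}$, $\mathit{sup}$; $f(\mathbf t)$ for a symbolic constant $f$ and a non-empty tuple of terms $\mathbf t$; $\mathit{op}(\mathbf t)$ for an $n$-ary operation name and an $n$-tuple of terms; $(t_1..t_2)$ for terms $t_1,t_2$. A term is ground if it has no variables, precomputed if it is ground and contains neither operation names nor $..$. A fixed total order on precomputed terms has $\mathit{inf}$ least, $\mathit{sup}$ greatest, and $\overline m\le\overline n$ iff $m\le n$; relation symbols are interpreted on precomputed terms via this order ($=$ is identity). The set $[t]$ of values of a ground term: $[t]=\{t\}$ for a numeral, symbolic constant, $\mathit{inf}$, $\mathit{sup}$; $[f(t_1,\dots,t_n)]=\{f(r_1,\dots,r_n): r_i\in[t_i]\}$;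 $[\mathit{op}(t_1,\dots,t_n)]$ is the set of numerals $\overline{\widehat{\mathit{op}}(k_1,\dots,k_n)}$ for $(k_1,\dots,k_n)$ in the domain of $\widehat{\mathit{op}}$ with $\overline{k_i}\in[t_i]$; $[(t_1..t_2)]$ is the set of numerals $\overline m$ such that $k_1\le m\le k_2$ for some $\overline{k_1}\in[t_1],\overline{k_2}\in[t_2]$. For tuples, $[t_1,\dots,t_n]$ is the set of tuples $r_1,\dots,r_n$ with $r_i\in[t_i]$. An atom is $p(\mathbf t)$ with $p$ a symbolic constant and $\mathbf t$ a possibly empty tuple of terms; a literal is an atom (positive) or $\mathit{not}\ A$ for an atom $A$ (negative); a comparison is $(t_1\prec t_2)$ with $\prec$ a relation symbol; an aggregate expression is $\alpha\{\mathbf t:\mathbf C\}\prec s$ with $\mathbf t$ a non-empty tuple of terms, $\mathbf C$ a conjunction of literals and comparisons, and $s$ a variable or precomputed term. A rule is $\mathit{Head}\leftarrow\mathit{Body}$ where $\mathit{Body}$ is a (possibly empty) conjunction of literals, comparisons and aggregate expressions, and $\mathit{Head}$ is an atom (basic rule), an expression $\{A\}$ with $A$ an atom (choice rule), or empty (constraint). A program is a set of rules. A variable of a rule is local if every occurrence of it lies in the left-hand part $\alpha\{\mathbf t:\mathbf C\}$ of an aggregate expression in the body, and global otherwise. A predicate symbol is a pair $p/n$; it occurs in an expression if the expression contains an atom $p(t_1,\dots,t_n)$. The vocabulary of a program is the set of atoms $p(\mathbf r)$ with $\mathbf r$ an $n$-tuple of precomputed terms and $p/n$ occurring in it. An interpretation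 is a set of atoms $p(\mathbf r)$ with $\mathbf r$ a tuple of precomputed terms. Tightness. $G_\Gamma$ is the directed graph whose vertices are the predicate symbols occurring in $\Gamma$, with an edge from $q/m$ to $p/n$ if some rule $R$ of $\Gamma$ has $q/m$ occurring in its head and $p/n$ occurring in a positive literal or in an aggregate expression in its body. $\Gamma$ is tight if $G_\Gamma$ is acyclic. Formulas and arguments (mutually recursive): (a) $p(\mathbf{arg})$ for a symbolic constant $p$ and tuple of arguments; (b) $(\mathit{arg}_1\prec\mathit{arg}_2)$; (c) $\mathit{arg}\in t$ for an argument and a term $t$; (d) $\bot$; (e) $F\to G$; (f) $\forall X F$ are formulas; (g) numerals, symbolic constants, variables, $\mathit{inf}$, $\mathit{sup}$; (h) $f(\mathbf{arg})$ for a symbolic constant $f$ and non-empty tuple of arguments; (i) $\alpha\{\mathbf X\mid F\}$ for an aggregate name, non-empty tuple $\mathbf X$ of distinct variables, and formula $F$, are arguments. Other connectives and $\exists$ are the usual abbreviations. Occurrences of $X$ are bound if inside $\forall XF$ or inside $\alpha\{\mathbf X\mid F\}$ with $X$ in $\mathbf X$. For an interpretation $\mathcal I$, closed formulas get truth values and closed arguments get precomputed terms: $p(\mathit{arg}_1,..,\mathit{arg}_k)$ is true iff $p(\mathit{arg}_1^{\mathcal I},\dots,\mathit{arg}_k^{\mathcal I})\in\mathcal I$; $\mathit{arg}_1\prec\mathit{arg}_2$ is true iff $\mathit{arg}_1^{\mathcal I}\prec\mathit{arg}_2^{\mathcal I}$; $\mathit{arg}\in t$ is true iff $\mathit{arg}^{\mathcal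 I}\in[t]$; $\bot$ false; $\to$ classical; $\forall XF$ true iff $F^X_r$ is true for every precomputed term $r$; numerals, symbolic constants, $\mathit{inf},\mathit{sup}$ denote themselves; $f(\dots)^{\mathcal I}=f(\mathit{arg}_1^{\mathcal I},\dots)$; $\alpha\{X_1,\dots,X_k\mid F\}^{\mathcal I}=\widehat\alpha(T)$ where $T$ is the set of tuples $r_1,\dots,r_k$ of precomputed terms with $F^{X_1\dots X_k}_{r_1\dots r_k}$ true. Formula representation. $\phi\,p(\mathbf t)=\exists\mathbf X(\mathbf X\in\mathbf t\wedge p(\mathbf X))$; $\phi(\mathit{not}\ p(\mathbf t))=\exists\mathbf X(\mathbf X\in\mathbf t\wedge\neg p(\mathbf X))$; $\phi(t_1\prec t_2)=\exists X_1X_2(X_1\in t_1\wedge X_2\in t_2\wedge X_1\prec X_2)$, with new variables ($\mathbf X\in\mathbf t$ is the conjunction of the componentwise memberships). For a list $\mathbf X$ of distinct variables, $\phi^{\mathbf X}$ equals $\phi$ on literals and comparisons, and maps the aggregate expression $\alpha\{\mathbf t:\mathbf C\}\prec s$ to $\exists Y(\alpha\{\mathbf Z\mid\exists\mathbf X(\mathbf Z\in\mathbf t\wedge\phi\mathbf C)\}\prec Y\wedge Y\in s)$ with new $\mathbf Z,Y$; on conjunctions it acts conjunct-wise. With $\mathbf X$ the local variables of the rule and $\mathbf V$ new variables: a basic rule $p(\mathbf t)\leftarrow\mathit{Body}$ is represented by $\mathbf V\in\mathbf t\wedge\phi^{\mathbf X}(\mathit{Body})\to p(\mathbf V)$; a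 choice rule $\{p(\mathbf t)\}\leftarrow\mathit{Body}$ by $\mathbf V\in\mathbf t\wedge\phi^{\mathbf X}(\mathit{Body})\wedge p(\mathbf V)\to p(\mathbf V)$; a constraint $\leftarrow\mathit{Body}$ by $\neg\phi^{\mathbf X}(\mathit{Body})$. Completion. The definition of $p/n$ in $\Gamma$ consists of the basic rules of $\Gamma$ with head $p(t_1,\dots,t_n)$ and the choice rules with head $\{p(t_1,\dots,t_n)\}$. If it is $\{R_1,\dots,R_k\}$, write the representation of $R_i$ as $F_i\to p(\mathbf V)$ with the same tuple $\mathbf V$ of distinct variables for all $i$; the completed definition of $p/n$ is $\forall\mathbf V(p(\mathbf V)\leftrightarrow\bigvee_{i=1}^k\exists\mathbf U_iF_i)$, where $\mathbf U_i$ lists the free variables of $F_i$ not in $\mathbf V$. The completion of a finite program $\Gamma$ consists of the completed definitions of all predicate symbols occurring in $\Gamma$ and the universal closures of the formula representations of all constraints of $\Gamma$. Stable models. Infinitary formulas over a set of atoms: atoms, $\bot$, $\mathcal H^\wedge$ and $\mathcal H^\vee$ for any set $\mathcal H$ of infinitary formulas, and $G\to H$; $\neg F$ is $F\to\bot$, $\top$ is $\bot\to\bot$; satisfaction is classical. The reduct $F^{\mathcal I}$ is $\bot$ if $\mathcal I\not\models F$, and otherwise: $A$ for an atom $A$; $\{G^{\mathcal I}:G\in\mathcal H\}^\wedge$ resp. $^\vee$ for $\mathcal H^\wedge$, $\mathcal H^\vee$; $G^{\mathcal I}\to H^{\mathcal I}$ for $G\to H$. $\mathcal I$ is a stable model of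 $F$ if it is a minimal (w.r.t. inclusion) set of atoms satisfying $F^{\mathcal I}$. Translation $\tau$: for a ground atom, $\tau p(\mathbf t)=\bigvee_{\mathbf r\in[\mathbf t]}p(\mathbf r)$; $\tau(\mathit{not}\ p(\mathbf t))=\bigvee_{\mathbf r\in[\mathbf t]}\neg p(\mathbf r)$; for a ground comparison, $\tau(t_1\prec t_2)$ is $\top$ if $r_1\prec r_2$ for some $r_1\in[t_1],r_2\in[t_2]$, else $\bot$. An aggregate expression $E=\alpha\{\mathbf t:\mathbf C\}\prec s$ is closed if $s$ is ground; let $\mathbf X$ list its variables, $A$ the set of tuples of precomputed terms of length $|\mathbf X|$, and for $\Delta\subseteq A$ let $[\Delta]=\bigcup_{\mathbf r\in\Delta}[\mathbf t^{\mathbf X}_{\mathbf r}]$; $\Delta$ justifies $E$ if $\widehat\alpha([\Delta])\prec s$. Then $\tau E$ is the conjunction, over all $\Delta\subseteq A$ not justifying $E$, of $\bigwedge_{\mathbf r\in\Delta}\tau(\mathbf C^{\mathbf X}_{\mathbf r})\to\bigvee_{\mathbf r\in A\setminus\Delta}\tau(\mathbf C^{\mathbf X}_{\mathbf r})$. $\tau$ acts conjunct-wise on conjunctions. A rule is closed if all its variables are local; for closed rules: $\tau(p(\mathbf t)\leftarrow\mathit{Body})=\tau(\mathit{Body})\to\bigwedge_{\mathbf r\in[\mathbf t]}p(\mathbf r)$; $\tau(\{p(\mathbf t)\}\leftarrow\mathit{Body})=\tau(\mathit{Body})\to\bigwedge_{\mathbf r\in[\mathbf t]}(p(\mathbf r)\vee\neg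 p(\mathbf r))$; $\tau(\leftarrow\mathit{Body})=\neg\tau(\mathit{Body})$. An instance of a rule is the closed rule obtained by substituting precomputed terms for its global variables. $\tau\Gamma$ is the conjunction of $\tau R$ over all instances $R$ of rules of $\Gamma$, and the stable models of $\Gamma$ are the stable models of $\tau\Gamma$ (as sets of atoms from the vocabulary of $\Gamma$). *)

(* Defs.v *)
From Stdlib Require List.
From Stdlib Require Import Relation_Operators.
From mathcomp Require Import all_boot all_order all_algebra.
From mathcomp Require Import boolp classical_sets.

Set Implicit Arguments.
Unset Strict Implicit.
Unset Printing Implicit Defensive.

(** * Signature and syntax of programs *)

(* [fresh] is an arbitrary supply of new variables; its existence says exactly
   that there are infinitely many variables.  Decidable equality on [sym] and
   [var] is no restriction classically.  Numerals are the integers themselves. *)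
Record signature := Signature {
  sym : eqType;
  var : eqType;
  opname : Type;
  arity : opname -> nat;
  aggname : Type;
  fresh : seq var -> var;
  fresh_notin : forall s : seq var, fresh s \notin s }.

Inductive cmp := CEq | CNe | CLt | CGt | CLe | CGe.

Section Syntax.
Variable S : signature.

(* In [TFun f t ts] the non-empty argument tuple is t :: ts.  The argument tuple
   of an operation is a function on ordinals, which fixes its length. *)
Inductive term : Type :=
| TNum of int
| TSym of sym S
| TVar of var S
| TInf
| TSup
| TFun of sym S & term & seq term
| TOp (o : opname S) of ('I_(arity o) -> term)
| TInterval of term & term.

(* The terms with neither variables, operation names nor intervals, as a type
   of their own; [emb] is the inclusion into all terms. *)
Inductive pterm : Type :=
| PNum of int
| PSym of sym S
| PInf
| PSup
| PFun of sym S & pterm & seq pterm.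

Fixpoint emb (r : pterm) : term :=
  match r with
  | PNum n => TNum n
  | PSym c => TSym c
  | PInf => TInf
  | PSup => TSup
  | PFun f r rs => TFun f (emb r) (map emb rs)
  end.

Inductive lit_or_cmp : Type :=
| Pos of sym S & seq term
| Neg of sym S & seq term
| Cmp of cmp & term & term.

(* alpha{t :: ts : C} rel s, where s is a variable or a precomputed term. *)
Record aggexp : Type := AggExp {
  ag_name : aggname S;
  ag_hd : term;
  ag_tl : seq term;
  ag_cond : seq lit_or_cmp;
  ag_rel : cmp;
  ag_bound : var S + pterm }.

Definition ag_tuple (E : aggexp) : seq term := ag_hd E :: ag_tl E.

Inductive conjunct : Type :=
| BLit of lit_or_cmp
| BAgg of aggexp.

Inductive rhead : Type :=
| HBasic of sym S & seq term
| HChoice of sym S & seq term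
| HNone.

Record rule : Type := Rule { head : rhead; body : seq conjunct }.

Definition program : Type := set rule.

(* A finite program is presented by a list of its rules. *)
Definition prog (G : seq rule) : program := fun R => List.In R G.

(** * Variables *)

Fixpoint term_vars (t : term) : seq (var S) :=
  match t with
  | TVar v => [:: v]
  | TFun _ t ts => term_vars t ++ flatten (map term_vars ts)
  | TOp _ ts => flatten [seq term_vars (ts i) | i <- enum 'I_(_)]
  | TInterval t1 t2 => term_vars t1 ++ term_vars t2
  | _ => [::]
  end.

Definition tuple_vars (ts : seq term) : seq (var S) :=
  flatten (map term_vars ts).

Definition lc_vars (L : lit_or_cmp) : seq (var S) :=
  match L with
  | Pos _ ts | Neg _ ts => tuple_vars ts
  | Cmp _ t1 t2 => term_vars t1 ++ term_vars t2
  end.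

Definition bound_term (s : var S + pterm) : term :=
  match s with inl v => TVar v | inr r => emb r end.

Definition ag_left_vars (E : aggexp) : seq (var S) :=
  tuple_vars (ag_tuple E) ++ flatten (map lc_vars (ag_cond E)).

Definition ag_vars (E : aggexp) : seq (var S) :=
  ag_left_vars E ++ term_vars (bound_term (ag_bound E)).

Definition conjunct_vars (B : conjunct) : seq (var S) :=
  match B with BLit L => lc_vars L | BAgg E => ag_vars E end.

Definition head_vars (H : rhead) : seq (var S) :=
  match H with HBasic _ ts | HChoice _ ts => tuple_vars ts | HNone => [::] end.

Definition rule_vars (R : rule) : seq (var S) :=
  head_vars (head R) ++ flatten (map conjunct_vars (body R)).

(* The variables having an occurrence outside all left-hand parts. *)
Definition global_vars (R : rule) : seq (var S) :=
  head_vars (head R) ++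
  flatten [seq match B with
               | BLit L => lc_vars L
               | BAgg E => term_vars (bound_term (ag_bound E))
               end | B <- body R].

Definition local_vars (R : rule) : seq (var S) :=
  undup [seq v <- rule_vars R | v \notin global_vars R].

Fixpoint fresh_seq (s : seq (var S)) (n : nat) : seq (var S) :=
  if n is m.+1 then fresh s :: fresh_seq (fresh s :: s) m else [::].

Lemma size_fresh_seq s n : size (fresh_seq s n) == n.
Proof. by elim: n s => //= n IHn s; rewrite eqSS. Qed.

Definition freshs (s : seq (var S)) (n : nat) : n.-tuple (var S) :=
  Tuple (size_fresh_seq s n).

Lemma fresh_seq_notin s n v : v \in fresh_seq s n -> v \notin s.
Proof.
elim: n s => //= n IHn s; rewrite inE => /predU1P[->|/IHn].
  exact: fresh_notin.
by rewrite inE negb_or => /andP[].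
Qed.

Lemma uniq_freshs s n : uniq (freshs s n).
Proof.
rewrite /=; elim: n s => //= n IHn s; rewrite IHn andbT.
by apply/negP => /fresh_seq_notin; rewrite inE eqxx.
Qed.

(** * Predicate symbols and tightness *)

Definition predsym : Type := (sym S * nat)%type.

Definition lc_preds (L : lit_or_cmp) : seq predsym :=
  match L with
  | Pos p ts | Neg p ts => [:: (p, size ts)]
  | Cmp _ _ _ => [::]
  end.

Definition ag_preds (E : aggexp) : seq predsym :=
  flatten (map lc_preds (ag_cond E)).

Definition conjunct_preds (B : conjunct) : seq predsym :=
  match B with BLit L => lc_preds L | BAgg E => ag_preds E end.

Definition head_preds (H : rhead) : seq predsym :=
  match H with
  | HBasic p ts | HChoice p ts => [:: (p, size ts)]
  | HNone => [::]
  end.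

Definition rule_preds (R : rule) : seq predsym :=
  head_preds (head R) ++ flatten (map conjunct_preds (body R)).

Definition occurs (G : program) (pn : predsym) : Prop :=
  exists R, G R /\ pn \in rule_preds R.

(* Occurrences in a positive literal or anywhere in an aggregate expression. *)
Definition dep_preds (B : conjunct) : seq predsym :=
  match B with
  | BLit (Pos p ts) => [:: (p, size ts)]
  | BLit _ => [::]
  | BAgg E => ag_preds E
  end.

Definition edge (G : program) (a b : predsym) : Prop :=
  exists R, [/\ G R, a \in head_preds (head R)
              & b \in flatten (map dep_preds (body R))].

Definition tight (G : program) : Prop :=
  forall a : predsym, ~ clos_trans predsym (edge G) a a.

(** * Interpretations *)

Definition gatom : Type := (sym S * seq pterm)%type.

Definition interpretation : Type := set gatom.

Definition vocabulary (G : program) : set gatom :=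
  fun A => occurs G (A.1, size A.2).

(** * Substitution of precomputed terms for variables *)

Definition psubst : Type := var S -> option pterm.

Fixpoint term_subst (e : psubst) (t : term) : term :=
  match t with
  | TVar v => if e v is Some r then emb r else TVar v
  | TFun f t ts => TFun f (term_subst e t) (map (term_subst e) ts)
  | TOp o ts => TOp (fun i => term_subst e (ts i))
  | TInterval t1 t2 => TInterval (term_subst e t1) (term_subst e t2)
  | _ => t
  end.

Definition lc_subst (e : psubst) (L : lit_or_cmp) : lit_or_cmp :=
  match L with
  | Pos p ts => Pos p (map (term_subst e) ts)
  | Neg p ts => Neg p (map (term_subst e) ts)
  | Cmp c t1 t2 => Cmp c (term_subst e t1) (term_subst e t2)
  end.

Definition bound_subst (e : psubst) (s : var S + pterm) : var S + pterm :=
  match s with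
  | inl v => if e v is Some r then inr r else inl v
  | inr r => inr r
  end.

Definition ag_subst (e : psubst) (E : aggexp) : aggexp :=
  AggExp (ag_name E) (term_subst e (ag_hd E)) (map (term_subst e) (ag_tl E))
    (map (lc_subst e) (ag_cond E)) (ag_rel E) (bound_subst e (ag_bound E)).

Definition conjunct_subst (e : psubst) (B : conjunct) : conjunct :=
  match B with
  | BLit L => BLit (lc_subst e L)
  | BAgg E => BAgg (ag_subst e E)
  end.

Definition head_subst (e : psubst) (H : rhead) : rhead :=
  match H with
  | HBasic p ts => HBasic p (map (term_subst e) ts)
  | HChoice p ts => HChoice p (map (term_subst e) ts)
  | HNone => HNone
  end.

Definition rule_subst (e : psubst) (R : rule) : rule :=
  Rule (head_subst e (head R)) (map (conjunct_subst e) (body R)).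

Definition bind (X : seq (var S)) (r : seq pterm) : psubst :=
  fun v => if v \in X then Some (nth PInf r (index v X)) else None.

Definition instance_of (R R' : rule) : Prop :=
  exists e : var S -> pterm,
    R' = rule_subst (fun v => if v \in global_vars R then Some (e v) else None)
           R.

(** * Formulas and arguments *)

Inductive arg : Type :=
| ANum of int
| ASym of sym S
| AVar of var S
| AInf
| ASup
| AFun of sym S & arg & seq arg
| AAgg (a : aggname S) (n : nat) (X : n.+1.-tuple (var S)) of
    uniq X & formula
with formula : Type :=
| FAtom of sym S & seq arg
| FCmp of cmp & arg & arg
| FIn of arg & term
| FBot
| FImp of formula & formula
| FAll of var S & formula.

Definition FNeg (F : formula) := FImp F FBot.
Definition FTop := FNeg FBot.
Definition FAnd (F G : formula) := FNeg (FImp F (FNeg G)).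
Definition FOr (F G : formula) := FImp (FNeg F) G.
Definition FIff (F G : formula) := FAnd (FImp F G) (FImp G F).
Definition FEx (x : var S) (F : formula) := FNeg (FAll x (FNeg F)).
Definition FAnds (Fs : seq formula) := foldr FAnd FTop Fs.
Definition FOrs (Fs : seq formula) := foldr FOr FBot Fs.
Definition FAlls (X : seq (var S)) (F : formula) := foldr FAll F X.
Definition FExs (X : seq (var S)) (F : formula) := foldr FEx F X.

Fixpoint arg_fv (a : arg) : seq (var S) :=
  match a with
  | AVar v => [:: v]
  | AFun _ a l => arg_fv a ++ flatten (map arg_fv l)
  | AAgg _ _ X _ F => [seq v <- fv F | v \notin X]
  | _ => [::]
  end
with fv (F : formula) : seq (var S) :=
  match F with
  | FAtom _ l => flatten (map arg_fv l)
  | FCmp _ a b => arg_fv a ++ arg_fv b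
  | FIn a t => arg_fv a ++ term_vars t
  | FBot => [::]
  | FImp F G => fv F ++ fv G
  | FAll x F => [seq v <- fv F | v != x]
  end.

Definition univ_closure (F : formula) : formula := FAlls (undup (fv F)) F.

(** * Formula representation of rules *)

(* X \in t, componentwise. *)
Definition FIns (X : seq (var S)) (ts : seq term) : formula :=
  FAnds [seq FIn (AVar xt.1) xt.2 | xt <- zip X ts].

(* Below, [avoid] contains all variables of the expression being translated (and
   the list X); the new variables are chosen outside [avoid]. *)
Definition phi_lc (avoid : seq (var S)) (L : lit_or_cmp) : formula :=
  match L with
  | Pos p ts =>
      let X := freshs avoid (size ts) in
      FExs X (FAnd (FIns X ts) (FAtom p (map AVar X)))
  | Neg p ts =>
      let X := freshs avoid (size ts) in
      FExs X (FAnd (FIns X ts) (FNeg (FAtom p (map AVar X))))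
  | Cmp c t1 t2 =>
      let x1 := fresh avoid in
      let x2 := fresh (x1 :: avoid) in
      FExs [:: x1; x2]
        (FAnds [:: FIn (AVar x1) t1; FIn (AVar x2) t2;
                   FCmp c (AVar x1) (AVar x2)])
  end.

Definition phi_ag (avoid X : seq (var S)) (E : aggexp) : formula :=
  let y := fresh avoid in
  let Z := freshs (y :: avoid) (size (ag_tl E)).+1 in
  let F := FExs X (FAnd (FIns Z (ag_tuple E))
             (FAnds (map (phi_lc (Z ++ y :: avoid)) (ag_cond E)))) in
  FEx y (FAnd (FCmp (ag_rel E) (AAgg (ag_name E) (uniq_freshs _ _ : uniq Z) F)
                 (AVar y))
              (FIn (AVar y) (bound_term (ag_bound E)))).

Definition phi_conjunct (avoid X : seq (var S)) (B : conjunct) : formula :=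
  match B with
  | BLit L => phi_lc avoid L
  | BAgg E => phi_ag avoid X E
  end.

Definition phi_body (avoid : seq (var S)) (R : rule) : formula :=
  FAnds (map (phi_conjunct avoid (local_vars R)) (body R)).

(* The antecedent of the representation of R with head variables V. *)
Definition antecedent (V : seq (var S)) (R : rule) : formula :=
  let B := phi_body (V ++ rule_vars R) R in
  match head R with
  | HBasic p ts => FAnd (FIns V ts) B
  | HChoice p ts => FAnds [:: FIns V ts; B; FAtom p (map AVar V)]
  | HNone => B
  end.

Definition representation (V : seq (var S)) (R : rule) : formula :=
  FImp (antecedent V R)
    match head R with
    | HBasic p _ | HChoice p _ => FAtom p (map AVar V)
    | HNone => FBot
    end.

(** * Completion *)

Definition definition_of (G : seq rule) (pn : predsym) : seq rule :=
  [seq R <- G | pn \in head_preds (head R)].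

Definition completed_definition (G : seq rule) (pn : predsym) : formula :=
  let V := freshs (flatten (map rule_vars G)) pn.2 in
  let disjunct R :=
    let F := antecedent V R in
    FExs (undup [seq v <- fv F | v \notin V]) F in
  FAlls V (FIff (FAtom pn.1 (map AVar V))
                (FOrs (map disjunct (definition_of G pn)))).

Definition completion (G : seq rule) : set formula :=
  fun F =>
    (exists2 pn, occurs (prog G) pn & F = completed_definition G pn) \/
    (exists R, [/\ prog G R, head R = HNone
                 & F = univ_closure (representation [::] R)]).

(** * Infinitary formulas and stable models *)

(* A set of infinitary formulas is given as a family over an arbitrary type. *)
Inductive iform : Type :=
| IAtom of gatom
| IBot
| IAnd (T : Type) of (T -> iform)
| IOr (T : Type) of (T -> iform)
| IImp of iform & iform.

Definition INeg (F : iform) := IImp F IBot.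
Definition ITop := IImp IBot IBot.
Definition IAnds (T : Type) (F : T -> iform) (s : seq T) :=
  IAnd (fun i : 'I_(size s) => F (tnth (in_tuple s) i)).
Definition IOr2 (F G : iform) := IOr (fun b : bool => if b then F else G).

(* Conjunction and disjunction over the elements of a set. *)
Definition IAnd_in (T : Type) (A : set T) (F : T -> iform) :=
  IAnd (fun x : {x : T | A x} => F (sval x)).
Definition IOr_in (T : Type) (A : set T) (F : T -> iform) :=
  IOr (fun x : {x : T | A x} => F (sval x)).

Fixpoint isat (I : interpretation) (F : iform) : Prop :=
  match F with
  | IAtom A => I A
  | IBot => False
  | IAnd _ H => forall x, isat I (H x)
  | IOr _ H => exists x, isat I (H x)
  | IImp F G => isat I F -> isat I G
  end.

Fixpoint reduct (I : interpretation) (F : iform) : iform :=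
  if `[< isat I F >] then
    match F with
    | IAtom A => IAtom A
    | IBot => IBot
    | IAnd _ H => IAnd (fun x => reduct I (H x))
    | IOr _ H => IOr (fun x => reduct I (H x))
    | IImp F G => IImp (reduct I F) (reduct I G)
    end
  else IBot.

(* Stable models of an infinitary formula over the set [sigma] of atoms. *)
Definition istable (sigma : set gatom) (F : iform) (I : interpretation) : Prop :=
  [/\ (I `<=` sigma)%classic, isat I (reduct I F)
    & forall J : interpretation, (J `<=` sigma)%classic -> (J `<=` I)%classic ->
        isat J (reduct I F) -> J = I].

End Syntax.

Arguments TInf {S}.
Arguments TSup {S}.
Arguments PInf {S}.
Arguments PSup {S}.
Arguments PNum {S} _.
Arguments HNone {S}.

(** * Semantics *)

(* [op_fun] is partial.  [agg_fun] is only ever applied to sets of non-empty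
   tuples, so its values elsewhere are immaterial. *)
Record semantics (S : signature) := Semantics {
  op_fun : forall o : opname S, (arity o).-tuple int -> option int;
  agg_fun : aggname S -> set (seq (pterm S)) -> pterm S;
  ple : rel (pterm S);
  ple_refl : reflexive ple;
  ple_anti : antisymmetric ple;
  ple_trans : transitive ple;
  ple_total : total ple;
  ple_inf : forall r, ple PInf r;
  ple_sup : forall r, ple r PSup;
  ple_num : forall m n : int, ple (PNum m) (PNum n) = (m <= n)%R }.

Section Semantics.
Variables (S : signature) (M : semantics S).

Definition cmp_holds (c : cmp) (r1 r2 : pterm S) : Prop :=
  match c with
  | CEq => r1 = r2
  | CNe => r1 <> r2
  | CLt => ple M r1 r2 /\ r1 <> r2
  | CGt => ple M r2 r1 /\ r1 <> r2
  | CLe => ple M r1 r2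
  | CGe => ple M r2 r1
  end.

(* The Cartesian product of a list of sets. *)
Fixpoint set_prod (As : seq (set (pterm S))) (rs : seq (pterm S)) : Prop :=
  match As, rs with
  | [::], [::] => True
  | A :: As', r :: rs' => A r /\ set_prod As' rs'
  | _, _ => False
  end.

(* Intended for ground terms; a variable is given no values. *)
Fixpoint values (t : term S) : set (pterm S) :=
  match t with
  | TVar _ => set0
  | TNum n => [set PNum n]%classic
  | TSym c => [set PSym c]%classic
  | TInf => [set PInf]%classic
  | TSup => [set PSup]%classic
  | TFun f t ts => fun r => exists r0 rs,
      [/\ values t r0, set_prod (map values ts) rs & r = PFun f r0 rs]
  | TOp o ts => fun r => exists (k : (arity o).-tuple int) (m : int),
      [/\ forall i, values (ts i) (PNum (tnth k i)),
          op_fun M k = Some m & r = PNum m]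
  | TInterval t1 t2 => fun r => exists k1 k2 m : int,
      [/\ values t1 (PNum k1), values t2 (PNum k2), (k1 <= m <= k2)%R
        & r = PNum m]
  end.

Definition tuple_values (ts : seq (term S)) : set (seq (pterm S)) :=
  set_prod (map values ts).

(** ** Truth of formulas *)

Definition upd (e : var S -> pterm S) (X : seq (var S)) (r : seq (pterm S)) :
    var S -> pterm S :=
  fun v => if v \in X then nth PInf r (index v X) else e v.

(* The substitutions of precomputed terms for variables performed while passing
   under binders are accumulated in the valuation [e]. *)
Fixpoint arg_val (I : interpretation S) (e : var S -> pterm S) (a : arg S) :
    pterm S :=
  match a with
  | ANum n => PNum n
  | ASym c => PSym c
  | AVar v => e v
  | AInf => PInf
  | ASup => PSup
  | AFun f a l => PFun f (arg_val I e a) (map (arg_val I e) l)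
  | AAgg al n X _ F =>
      agg_fun M al (fun s => exists r : n.+1.-tuple (pterm S),
        s = r /\ truth I (upd e X r) F)
  end
with truth (I : interpretation S) (e : var S -> pterm S) (F : formula S) :
    Prop :=
  match F with
  | FAtom p l => I (p, map (arg_val I e) l)
  | FCmp c a b => cmp_holds c (arg_val I e a) (arg_val I e b)
  | FIn a t => values (term_subst (fun v => Some (e v)) t) (arg_val I e a)
  | FBot => False
  | FImp F G => truth I e F -> truth I e G
  | FAll x F => forall r : pterm S, truth I (upd e [:: x] [:: r]) F
  end.

(* For closed formulas the choice of valuation is irrelevant. *)
Definition satisfies (I : interpretation S) (T : set (formula S)) : Prop :=
  forall F, T F -> truth I (fun=> PInf) F.

(** ** Stable models of programs *)

Definition tau_lc (L : lit_or_cmp S) : iform S :=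
  match L with
  | Pos p ts => IOr_in (tuple_values ts) (fun r => IAtom (p, r))
  | Neg p ts => IOr_in (tuple_values ts) (fun r => INeg (IAtom (p, r)))
  | Cmp c t1 t2 =>
      if `[< exists r1 r2, [/\ values t1 r1, values t2 r2 & cmp_holds c r1 r2] >]
      then ITop S else IBot S
  end.

Section Aggregate.
Variable E : aggexp S.

Let X := undup (ag_vars E).
Let A := (size X).-tuple (pterm S).

Definition delta_values (D : set A) : set (seq (pterm S)) :=
  fun u => exists2 r : A, D r &
    tuple_values (map (term_subst (bind X r)) (ag_tuple E)) u.

(* Intended for closed E, whose bound is a precomputed term. *)
Definition justifies (D : set A) : Prop :=
  if ag_bound E is inr s
  then cmp_holds (ag_rel E) (agg_fun M (ag_name E) (delta_values D)) s
  else False.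

Definition tau_cond (r : A) : iform S :=
  IAnds tau_lc (map (lc_subst (bind X r)) (ag_cond E)).

Definition tau_ag : iform S :=
  IAnd_in (fun D : set A => ~ justifies D) (fun D =>
    IImp (IAnd_in D tau_cond) (IOr_in (~` D)%classic tau_cond)).

End Aggregate.

Definition tau_conjunct (B : conjunct S) : iform S :=
  match B with
  | BLit L => tau_lc L
  | BAgg E => tau_ag E
  end.

Definition tau_rule (R : rule S) : iform S :=
  let B := IAnds tau_conjunct (body R) in
  match head R with
  | HBasic p ts =>
      IImp B (IAnd_in (tuple_values ts) (fun r => IAtom (p, r)))
  | HChoice p ts =>
      IImp B (IAnd_in (tuple_values ts)
                (fun r => IOr2 (IAtom (p, r)) (INeg (IAtom (p, r)))))
  | HNone => INeg B
  end.

Definition tau (G : program S) : iform S :=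
  IAnd_in (fun R' => exists2 R, G R & instance_of R R') tau_rule.

Definition stable_model (G : program S) (I : interpretation S) : Prop :=
  istable (vocabulary G) (tau G) I.

End Semantics.

(* Main.v *)
(* The formula representation of a rule body is true under a valuation e exactly
   when I satisfies the translation tau of the instance of the body given by e;
   for an aggregate expression this holds because the conjunction over all
   non-justifying Delta excludes exactly the possibility that the set of tuples
   satisfying the condition is not justifying.  The completion therefore says
   that I satisfies tau of the program and that every atom of I is the head of a
   rule instance whose body is true in I.

   A stable model is supported in this sense, because otherwise I minus the
   unsupported atom would satisfy the reduct.  Conversely, tightness and
   finiteness give a rank on predicate symbols decreasing along the edges of the
   dependency graph.  If J is a subset of I satisfying the reduct, then every
   atom of I is in J by induction on its rank: J agrees with I on what the body
   of the supporting rule depends on, and negative literals can only become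
   easier to satisfy, so J satisfies the reduct of that body. *)

Require Import Defs.
From Stdlib Require Import Relation_Operators.
From mathcomp Require Import all_boot all_order all_algebra.
From mathcomp Require Import boolp classical_sets.

Set Implicit Arguments.
Unset Strict Implicit.
Unset Printing Implicit Defensive.

Local Notation head := Defs.head.

(** * Substitution in terms, literals and aggregate expressions *)

Section Terms.
Variable S : signature.
Implicit Types (t : term S) (ts : seq (term S)) (r : pterm S)
  (e f : psubst S) (v : var S).

Fixpoint Forall (T : Type) (P : T -> Prop) (s : seq T) : Prop :=
  if s is x :: s' then P x /\ Forall P s' else True.

(** Terms occur inside argument lists, so the [TFun] case needs a hypothesis for every member of the
    list; an inner induction on the list supplies it. *)
Lemma nested_term_ind (P : term S -> Prop) :
  (forall n, P (TNum S n)) -> (forall c, P (TSym c)) ->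
  (forall v, P (TVar v)) -> P TInf -> P TSup ->
  (forall (g : sym S) t ts, P t -> Forall P ts -> P (TFun g t ts)) ->
  (forall o (ts : 'I_(arity o) -> term S), (forall i, P (ts i)) ->
     P (TOp ts)) ->
  (forall t1 t2, P t1 -> P t2 -> P (TInterval t1 t2)) ->
  forall t, P t.
Proof.
move=> Pn Pc Pv Pi Ps Pf Po Pl; fix IH 1 => -[n|c|v|||f t ts|o ts|t1 t2].
- exact: Pn.
- exact: Pc.
- exact: Pv.
- exact: Pi.
- exact: Ps.
- apply: Pf; first exact: IH.
  by elim: ts => //= t' ts IHts; split.
- by apply: Po => i; apply: IH.
- by apply: Pl; apply: IH.
Qed.

Lemma nested_pterm_ind (P : pterm S -> Prop) :
  (forall n, P (PNum n)) -> (forall c, P (PSym c)) -> P PInf -> P PSup ->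
  (forall (g : sym S) r rs, P r -> Forall P rs -> P (PFun g r rs)) -> forall r, P r.
Proof.
move=> Pn Pc Pi Ps Pf; fix IH 1 => -[n|c|||f r rs].
- exact: Pn.
- exact: Pc.
- exact: Pi.
- exact: Ps.
- apply: Pf; first exact: IH.
  by elim: rs => //= r' rs IHrs; split.
Qed.

Lemma term_subst_emb e r : term_subst e (emb r) = emb r.
Proof.
elim/nested_pterm_ind: r => //= f r rs -> IHrs; congr TFun.
by elim: rs IHrs => //= r' rs IH [-> /IH ->].
Qed.

Lemma eq_term_subst e f t :
  {in term_vars t, e =1 f} -> term_subst e t = term_subst f t.
Proof.
elim/nested_term_ind: t => //=.
- by move=> v ->; rewrite ?inE.
- move=> g t ts IHt IHts ef; congr TFun.
    by apply: IHt => v vt; apply: ef; rewrite mem_cat vt.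
  have {IHt}: {in flatten (map (@term_vars S) ts), e =1 f}.
    by move=> v vt; apply: ef; rewrite mem_cat vt orbT.
  elim: ts {ef} IHts => //= t' ts IH [IHt' /IH{}IH] ef.
  rewrite IHt' ?IH// => v vt; apply: ef; rewrite mem_cat vt ?orbT//.
- move=> o ts IH ef; congr TOp; apply/funext => i; apply: IH => v vt.
  apply: ef; apply/flattenP; exists (term_vars (ts i)) => //.
  by apply/map_f; rewrite mem_enum.
- move=> t1 t2 IH1 IH2 ef; congr TInterval; [apply: IH1|apply: IH2];
  by move=> v vt; apply: ef; rewrite mem_cat vt ?orbT.
Qed.

(** Values of [e] are precomputed, hence free of variables, so a later substitution leaves them
    alone. *)
Definition then_subst e f : psubst S :=
  fun v => if e v is Some r then Some r else f v.

Lemma term_subst_comp e f t :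
  term_subst f (term_subst e t) = term_subst (then_subst e f) t.
Proof.
elim/nested_term_ind: t => //=.
- by move=> v; rewrite /then_subst; case: (e v) => //= r; rewrite term_subst_emb.
- move=> g t ts -> IHts; congr TFun.
  by elim: ts IHts => //= t' ts IH [-> /IH ->].
- by move=> o ts IH; congr TOp; apply/funext => i.
- by move=> t1 t2 -> ->.
Qed.

(** Serves for instances of aggregate expressions: local variables survive the substitution for the
    global ones, and so are among the variables over which [tau_ag] forms its tuples. *)
Lemma term_subst_vars e t v : e v = None ->
  v \in term_vars t -> v \in term_vars (term_subst e t).
Proof.
move=> ev; elim/nested_term_ind: t => //=.
- by move=> w; rewrite inE => /eqP <-; rewrite ev inE.
- move=> g t ts IHt IHts; rewrite !mem_cat => /orP[/IHt -> //|vts].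
  apply/orP; right; elim: ts IHts vts => //= t' ts IH [IHt' /IH{}IH].
  by rewrite !mem_cat => /orP[/IHt' ->|/IH ->]; rewrite ?orbT.
- move=> o ts IH /flattenP[_ /mapP[i _ ->]] /IH vi.
  apply/flattenP; eexists; last exact: vi.
  by apply/(map_f (fun i => term_vars (term_subst e (ts i)))); rewrite mem_enum.
- move=> t1 t2 IH1 IH2; rewrite !mem_cat.
  by case/orP => [/IH1|/IH2] ->; rewrite ?orbT.
Qed.

Lemma eq_map_term_subst e f ts :
  {in tuple_vars ts, e =1 f} -> map (term_subst e) ts = map (term_subst f) ts.
Proof.
rewrite /tuple_vars; elim: ts => //= t ts IH ef; congr cons.
  by apply: eq_term_subst => v vt; apply: ef; rewrite mem_cat vt.
by apply: IH => v vt; apply: ef; rewrite mem_cat vt orbT.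
Qed.

Lemma map_term_subst_comp e f ts :
  map (term_subst f) (map (term_subst e) ts)
  = map (term_subst (then_subst e f)) ts.
Proof. by rewrite -map_comp; apply: eq_map => t /=; apply: term_subst_comp. Qed.

Lemma tuple_subst_vars e ts v : e v = None ->
  v \in tuple_vars ts -> v \in tuple_vars (map (term_subst e) ts).
Proof.
move=> ev; rewrite /tuple_vars; elim: ts => //= t ts IH; rewrite !mem_cat.
by case/orP => [/(term_subst_vars ev)|/IH] ->; rewrite ?orbT.
Qed.

Lemma eq_lc_subst e f (L : lit_or_cmp S) :
  {in lc_vars L, e =1 f} -> lc_subst e L = lc_subst f L.
Proof.
case: L => [p ts|p ts|c t1 t2] /= ef.
- by rewrite (eq_map_term_subst ef).
- by rewrite (eq_map_term_subst ef).
- by congr Cmp; apply: eq_term_subst => v vt; apply: ef;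
    rewrite mem_cat vt ?orbT.
Qed.

Lemma lc_subst_comp e f (L : lit_or_cmp S) :
  lc_subst f (lc_subst e L) = lc_subst (then_subst e f) L.
Proof.
by case: L => [p ts|p ts|c t1 t2] /=;
  rewrite ?map_term_subst_comp ?term_subst_comp.
Qed.

Lemma lc_subst_vars e (L : lit_or_cmp S) v : e v = None ->
  v \in lc_vars L -> v \in lc_vars (lc_subst e L).
Proof.
move=> ev; case: L => [p ts|p ts|c t1 t2] /=; try exact: tuple_subst_vars.
by rewrite !mem_cat => /orP[] /(term_subst_vars ev) ->; rewrite ?orbT.
Qed.

Lemma ag_subst_left_vars e (E : aggexp S) v : e v = None ->
  v \in ag_left_vars E -> v \in ag_left_vars (ag_subst e E).
Proof.
move=> ev; rewrite /ag_left_vars mem_cat => vE; rewrite mem_cat.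
case/orP: vE => [vt|vC]; apply/orP; first by left; apply: (tuple_subst_vars ev vt).
right; move: vC => /=; elim: (ag_cond E) => //= L C IH; rewrite !mem_cat.
by case/orP => [/(lc_subst_vars ev)|/IH] ->; rewrite ?orbT.
Qed.

End Terms.

Section Semantics.
Variables (S : signature) (M : semantics S).
Implicit Types (I J : interpretation S) (e f : var S -> pterm S)
  (X : seq (var S)) (F : formula S).

Lemma values_emb (r : pterm S) : values M (emb r) = [set r]%classic.
Proof.
elim/nested_pterm_ind: r => //= f r rs IHr IHrs; rewrite IHr.
have rsP us : set_prod (map (values M) (map (@emb S) rs)) us <-> us = rs.
  elim: rs IHrs us => [_|r' rs IH [r'E /IH{}IH]] [|u us] //=.
  by rewrite r'E IH /=; split=> [[-> ->]|[-> ->]].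
apply/seteqP; split=> u /=.
  by move=> [r0 [us [-> /rsP -> ->]]].
by move=> ->; exists r, rs; split => //; apply/rsP.
Qed.

Lemma set_prod_size (As : seq (set (pterm S))) (rs : seq (pterm S)) :
  set_prod As rs -> size rs = size As.
Proof. by elim: As rs => [|A As IH] [|r rs] //= [_ /IH ->]. Qed.

Lemma tuple_values_size (ts : seq (term S)) rs :
  tuple_values M ts rs -> size rs = size ts.
Proof. by move/set_prod_size; rewrite size_map. Qed.

(** * Truth and valuations *)

Lemma upd1E e x r v : upd e [:: x] [:: r] v = if v == x then r else e v.
Proof. by rewrite /upd inE /=; case: eqVneq => // ->; rewrite eqxx. Qed.

Lemma upd_notin e X rs v : v \notin X -> upd e X rs v = e v.
Proof. by rewrite /upd => /negPf ->. Qed.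

Lemma map_upd e X rs : uniq X -> size rs = size X -> map (upd e X rs) X = rs.
Proof.
move=> uX sX; apply: (@eq_from_nth _ PInf) => [|i]; first by rewrite size_map.
rewrite size_map => iX; case: X iX uX sX => // x X iX uX sX.
by rewrite (nth_map x)// /upd mem_nth// index_uniq.
Qed.

Lemma upd_map e f X : {in [predC X], e =1 f} -> upd e X (map f X) = f.
Proof.
move=> ef; apply/funext => v; rewrite /upd; case: ifPn => vX; last exact: ef.
case: X vX {ef} => // x X vX.
by rewrite (nth_map x) ?index_mem// nth_index.
Qed.

Lemma upd_map_in e f X : {in X, upd e X (map f X) =1 f}.
Proof.
by move=> v vX; rewrite /upd vX (nth_map v) ?index_mem// nth_index.
Qed.

Lemma eq_upd e f X Y rs : {in [seq v <- Y | v \notin X], e =1 f} ->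
  {in Y, upd e X rs =1 upd f X rs}.
Proof.
move=> ef v vY; rewrite /upd; case: ifPn => // vX.
by apply: ef; rewrite mem_filter vX.
Qed.

Definition all_some e : psubst S := fun v => Some (e v).

(** Aggregate arguments contain formulas and formulas contain arguments, so both claims are proved
    by one mutual recursion. *)
Fixpoint eq_arg_val I e f (a : arg S) :
  {in arg_fv a, e =1 f} -> arg_val M I e a = arg_val M I f a
with eq_truth I e f (F : formula S) :
  {in fv F, e =1 f} -> truth M I e F <-> truth M I f F.
Proof.
- case: a => [n|c|v|||g a l|al n X uX F] /= ef //.
  + by apply: ef; rewrite inE.
  + rewrite (eq_arg_val I e f a); last first.
      by move=> v va; apply: ef; rewrite mem_cat va.
    congr PFun.
    have {}ef : {in flatten (map (@arg_fv S) l), e =1 f}.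
      by move=> v va; apply: ef; rewrite mem_cat va orbT.
    elim: l ef => //= b l IH ef; rewrite (eq_arg_val I e f b) ?IH//.
      by move=> v va; apply: ef; rewrite mem_cat va orbT.
    by move=> v va; apply: ef; rewrite mem_cat va.
  + congr agg_fun; apply/funext => s; apply/propext; split=> -[r [-> Fr]];
      exists r; split=> //; move: Fr; apply eq_truth;
      apply: eq_upd => v vF; rewrite ef//.
- case: F => [p l|c a b|a t||F G|x F] /= ef //.
  + suff -> : map (arg_val M I e) l = map (arg_val M I f) l by [].
    elim: l ef => //= b l IH ef; rewrite (eq_arg_val I e f b) ?IH//.
      by move=> v va; apply: ef; rewrite mem_cat va orbT.
    by move=> v va; apply: ef; rewrite mem_cat va.
  + rewrite (eq_arg_val I e f a) 1?(eq_arg_val I e f b)//.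
      by move=> v va; apply: ef; rewrite mem_cat va orbT.
    by move=> v va; apply: ef; rewrite mem_cat va.
  + rewrite (eq_arg_val I e f a); last first.
      by move=> v va; apply: ef; rewrite mem_cat va.
    suff -> : term_subst (fun v => Some (e v)) t
              = term_subst (fun v => Some (f v)) t by [].
    by apply: eq_term_subst => v vt; rewrite ef// mem_cat vt orbT.
  + have eF : {in fv F, e =1 f} by move=> v va; apply: ef; rewrite mem_cat va.
    have eG : {in fv G, e =1 f}.
      by move=> v va; apply: ef; rewrite mem_cat va orbT.
    by split=> FG /(eq_truth _ _ _ _ eF)/FG/(eq_truth _ _ _ _ eG).
  + have xF r : {in fv F, upd e [:: x] [:: r] =1 upd f [:: x] [:: r]}.
      move=> v vF; rewrite !upd1E; case: ifPn => // vx.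
      by apply: ef; rewrite mem_filter vx.
    by split=> Fr r; move: (Fr r); apply eq_truth => v vF; rewrite xF.
Qed.

Lemma truth_and I e F G :
  truth M I e (FAnd F G) <-> truth M I e F /\ truth M I e G.
Proof. by split=> /= [|[? ?]]; [apply: contra_notP; tauto|tauto]. Qed.

Lemma truth_or I e F G :
  truth M I e (FOr F G) <-> truth M I e F \/ truth M I e G.
Proof. by move=> /=; have [] := EM (truth M I e F); tauto. Qed.

Lemma truth_iff I e F G :
  truth M I e (FIff F G) <-> (truth M I e F <-> truth M I e G).
Proof. by rewrite /FIff truth_and /=; tauto. Qed.

(** Iterated quantifiers become one quantifier over valuations that change at most on [X]; in this
    form [X] may contain repetitions. *)
Lemma truth_alls I e X F : truth M I e (FAlls X F) <->
  forall f, {in [predC X], e =1 f} -> truth M I f F.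
Proof.
elim: X e => [|x X IH] e /=.
  split=> [Fe f ef|]; last by apply.
  by have -> : f = e by apply/funext => v; rewrite ef.
split=> [FX f ef|FX r].
  have /IH := FX (f x); apply=> v vX; rewrite upd1E.
  by case: eqVneq => [->//|vx]; apply: ef; rewrite !inE negb_or vx.
apply/IH => f ef; apply: FX => v; rewrite !inE negb_or => /andP[vx vX].
by rewrite -ef// upd1E (negPf vx).
Qed.

Lemma truth_exs I e X F : truth M I e (FExs X F) <->
  exists2 f, {in [predC X], e =1 f} & truth M I f F.
Proof.
(* Existential quantifiers abbreviate negated universal ones, so duality reduces the claim to
   [truth_alls]. *)
suff: truth M I e (FExs X F) <-> ~ truth M I e (FAlls X (FNeg F)).
  rewrite truth_alls => ->; split=> [|[f ef Ff] /(_ f ef)/(_ Ff)//].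
  apply: contra_notP => nF f ef /= Ff; by apply: nF; exists f.
elim: X e => [|x X IH] e /=; first by split; [tauto|apply: contrapT].
split; apply: contra_not => H r.
- by move/IH; apply.
- by apply: contrapT => nF; apply: (H r); apply/IH.
Qed.

Lemma truth_ors I e (T : Type) (H : T -> formula S) (s : seq T) :
  truth M I e (FOrs (map H s)) <->
  exists2 x, List.In x s & truth M I e (H x).
Proof.
elim: s => [|x s IH]; first by split=> // -[].
rewrite [FOrs _]/= truth_or IH; split=> [[Hx|[y ys Hy]]|[y /= [<-|ys]] Hy].
- by exists x => //; left.
- by exists y => //; right.
- by left.
- by right; exists y.
Qed.

Lemma truth_ins I e X (ts : seq (term S)) : size X = size ts ->
  truth M I e (FIns X ts) <->
  tuple_values M (map (term_subst (all_some e)) ts) (map e X).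
Proof.
rewrite /FIns; elim: X ts => [|x X IH] [|t ts] // sX; first by split=> // _ [].
have /IH IHts : size X = size ts by case: sX.
by rewrite [FAnds _]/= truth_and IHts.
Qed.

(** * Formula representations and infinitary translations *)

(** As no variable of [X] occurs in [ts], rebinding [X] leaves the values of [ts] unchanged, and the
    quantifiers range exactly over the tuples of values. The equation on [map (upd e X rs) X] later
    evaluates the atom in their scope. *)
Lemma truth_exs_ins I e X (ts : seq (term S)) F :
  uniq X -> size X = size ts -> {in tuple_vars ts, forall v, v \notin X} ->
  truth M I e (FExs X (FAnd (FIns X ts) F)) <->
  exists rs, [/\ tuple_values M (map (term_subst (all_some e)) ts) rs,
    map (upd e X rs) X = rs & truth M I (upd e X rs) F].
Proof.
move=> uX sX tsX; rewrite truth_exs; split=> [[f ef]|[rs [tsrs Xrs Frs]]].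
  move=> /truth_and[/(truth_ins _ _ sX) tsf Ff]; exists (map f X).
  rewrite upd_map// (@eq_map_term_subst _ _ (all_some f))// => v /tsX vX.
  by rewrite /all_some ef.
exists (upd e X rs) => [v vX|]; first by rewrite upd_notin.
apply/truth_and; split=> //; apply/(truth_ins _ _ sX).
rewrite Xrs (@eq_map_term_subst _ _ (all_some e))// => v /tsX vX.
by rewrite /all_some upd_notin.
Qed.

Lemma freshs_notin (s X : seq (var S)) n :
  {subset X <= s} -> {in X, forall v, v \notin (freshs s n : seq (var S))}.
Proof.
by move=> Xs v /Xs vs; apply/negP => /fresh_seq_notin; rewrite vs.
Qed.

Lemma truth_ands I e (T : Type) (H : T -> formula S) (s : seq T) :
  truth M I e (FAnds (map H s)) <->
  forall x, List.In x s -> truth M I e (H x).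
Proof.
elim: s => [|x s IH]; first by split=> // _; apply.
rewrite [FAnds _]/= truth_and IH; split=> [[Hx Hs] y [<-|/Hs]//|Hs].
by split=> [|y ys]; apply: Hs; [left|right].
Qed.

Lemma truth_ands3 I e F G H : truth M I e (FAnds [:: F; G; H]) <->
  truth M I e F /\ truth M I e G /\ truth M I e H.
Proof. by rewrite [FAnds _]/= !truth_and /=; tauto. Qed.

(** For literals, the new variables run through the value tuples that index the disjunction in
    [tau_lc]. For a comparison, [tau_lc] has already decided whether suitable values exist. *)
Lemma truth_phi_lc I e (avoid : seq (var S)) (L : lit_or_cmp S) :
  {subset lc_vars L <= avoid} ->
  truth M I e (phi_lc avoid L) <->
  isat I (tau_lc M (lc_subst (all_some e) L)).
Proof.
case: L => [p ts|p ts|c t1 t2] avoidL.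
- have X_ts := freshs_notin (size ts) avoidL.
  have := uniq_freshs avoid (size ts).
  have : size (freshs avoid (size ts)) = size ts by rewrite size_tuple.
  move: X_ts; rewrite /=; move: (fresh_seq _ _) => X X_ts sX uX.
  rewrite (truth_exs_ins _ _ _ uX sX X_ts) /=; split.
    by move=> [rs [tsrs]]; rewrite -map_comp => ->; exists (exist _ _ tsrs).
  move=> [[rs tsrs] /= Irs]; exists rs; rewrite -map_comp map_upd//.
  by rewrite (tuple_values_size tsrs) size_map sX.
- have X_ts := freshs_notin (size ts) avoidL.
  have := uniq_freshs avoid (size ts).
  have : size (freshs avoid (size ts)) = size ts by rewrite size_tuple.
  move: X_ts; rewrite /=; move: (fresh_seq _ _) => X X_ts sX uX.
  rewrite (truth_exs_ins _ _ _ uX sX X_ts) /=; split.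
    by move=> [rs [tsrs]]; rewrite -map_comp => ->; exists (exist _ _ tsrs).
  move=> [[rs tsrs] /= Irs]; exists rs; rewrite -map_comp map_upd//.
  by rewrite (tuple_values_size tsrs) size_map sX.
- set x1 := fresh avoid; set x2 := fresh (x1 :: avoid).
  have x12 : x2 != x1.
    by have := fresh_notin (x1 :: avoid); rewrite inE negb_or => /andP[].
  have tx f : {in [predC [:: x1; x2]], e =1 f} ->
      (term_subst (all_some f) t1 = term_subst (all_some e) t1) *
      (term_subst (all_some f) t2 = term_subst (all_some e) t2).
    move=> ef; have fe v : v \in term_vars t1 ++ term_vars t2 -> f v = e v.
      (* The list [[:: x1; x2]] is [freshs avoid 2] unfolded. *)
      move=> /(freshs_notin 2 avoidL) vx; rewrite -ef//.
    by split; apply: eq_term_subst => v vt; rewrite /all_some fe// mem_cat vt ?orbT.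
  have -> : phi_lc avoid (Cmp c t1 t2) = FExs [:: x1; x2] (FAnds
      [:: FIn (AVar x1) t1; FIn (AVar x2) t2; FCmp c (AVar x1) (AVar x2)]) by [].
  rewrite truth_exs [tau_lc _ _]/=; case: asboolP => [[r1 [r2 [v1 v2 c12]]]|nr].
    split=> [_ []|_]; exists (upd e [:: x1; x2] [:: r1; r2]).
      by move=> v vx; rewrite upd_notin.
    have fx1 : upd e [:: x1; x2] [:: r1; r2] x1 = r1 by rewrite /upd /= inE eqxx.
    have fx2 : upd e [:: x1; x2] [:: r1; r2] x2 = r2.
      by rewrite /upd /= !inE eqxx orbT eq_sym (negPf x12).
    have ef : {in [predC [:: x1; x2]], e =1 upd e [:: x1; x2] [:: r1; r2]}.
      by move=> v vx; rewrite upd_notin.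
    by apply/truth_ands3; do !split; rewrite /= ?fx1 ?fx2// -/(all_some _) tx.
  split=> // -[f ef] /truth_ands3[/= v1 [v2 c12]].
  by apply: nr; exists (f x1), (f x2); rewrite -!(tx f).
Qed.

Lemma In_tnth (T : Type) (s : seq T) i : List.In (tnth (in_tuple s) i) s.
Proof.
(* The element itself serves as the default of [nth], and is then generalized to an arbitrary [d]
   for the induction. *)
case: i => n ns; rewrite (tnth_nth (tnth (in_tuple s) (Ordinal ns))) /=.
move: (tnth _ _) => d.
by elim: s n ns => //= x s IH [|n] ns; [left|right; apply: IH].
Qed.

Lemma isat_IAnds I (T : Type) (H : T -> iform S) (s : seq T) :
  isat I (IAnds H s) <-> forall x, List.In x s -> isat I (H x).
Proof.
rewrite /IAnds /=; split=> [Hs x xs|Hs i]; last exact/Hs/In_tnth.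
suff [i xi] : exists i, tnth (in_tuple s) i = x by rewrite -xi.
suff [n ns xn] : exists2 n, n < size s & nth x s n = x.
  by exists (Ordinal ns); rewrite (tnth_nth x).
elim: s xs {Hs} => //= y s IH [<-|/IH[n ns xn]]; first by exists 0.
by exists n.+1.
Qed.

(** The implication for [D] fails exactly when all tuples in [D] and none outside satisfy the
    condition, that is, when [D] is [sats]. Hence the conjunction fails exactly when [sats] is one
    of the non-justifying sets. *)
Lemma isat_tau_ag I (E : aggexp S) : isat I (tau_ag M E) <->
  justifies M [set r : (size (undup (ag_vars E))).-tuple (pterm S) |
                isat I (tau_cond M r)]%classic.
Proof.
set sats := [set r | _]%classic; rewrite /=; split=> [H|jE [D nD] /= HD].
  apply: contrapT => nj.
  by case: (H (exist (fun D => ~ justifies M D) sats nj)) => [[r Hr] //|[r nr] /= Hr].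
apply: contrapT => nr; apply: nD; suff -> : D = sats by [].
apply/seteqP; split=> r /= Dr; first exact: (HD (exist _ r Dr)).
by apply: contrapT => nDr; apply: nr; exists (exist _ r nDr).
Qed.

Lemma In_map (T T' : Type) (h : T -> T') (s : seq T) y :
  List.In y (map h s) <-> exists2 x, List.In x s & y = h x.
Proof.
elim: s => [|x s IH] /=; first by split=> // -[].
rewrite IH; split=> [[<-|[z zs ->]]|[z [->|zs] ->]].
- by exists x => //; left.
- by exists z => //; right.
- by left.
- by right; exists z.
Qed.

Lemma isat_IAnds_map I (T T' : Type) (H : T' -> iform S) (h : T -> T')
    (s : seq T) :
  isat I (IAnds H (map h s)) <-> forall x, List.In x s -> isat I (H (h x)).
Proof.
rewrite isat_IAnds; split=> [Hs x xs|Hs y /In_map[x xs ->]]; last exact: Hs.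
by apply: Hs; apply/In_map; exists x.
Qed.

Lemma In_flatten_map (T : Type) (T' : eqType) (h : T -> seq T') (s : seq T) y :
  y \in flatten (map h s) <-> exists2 x, List.In x s & y \in h x.
Proof.
elim: s => [|x s IH] /=; first by split=> // -[].
rewrite mem_cat; split=> [/orP[yx|/IH[z zs yz]]|[z [->|zs] yz]].
- by exists x => //; left.
- by exists z => //; right.
- by rewrite yz.
- by apply/orP; right; apply/IH; exists z.
Qed.

(** With [g] selecting the global variables, this is the substitution that forms an instance; local
    variables stay in place. *)
Definition subst_on (g : pred (var S)) e : psubst S :=
  fun v => if g v then Some (e v) else None.

(** * Aggregate expressions *)

Section PhiAg.
Variables (I : interpretation S) (e : var S -> pterm S).
Variables (avoid X : seq (var S)) (E : aggexp S) (g : pred (var S)).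
Hypothesis avoidE : {subset ag_vars E <= avoid}.
Hypothesis avoidX : {subset X <= avoid}.
Hypothesis left_vars : {in ag_left_vars E, forall v, g v || (v \in X)}.
Hypothesis X_local : {in X, forall v, ~~ g v}.
Hypothesis bound_global :
  {in term_vars (bound_term (ag_bound E)), forall v, g v}.

Let E' := ag_subst (subst_on g e) E.
Let XE := undup (ag_vars E').

(** The common meaning of the two sides: [h] stands for [e] combined with a tuple of [tau_ag], and
    also for the valuation reached under the quantifiers of [phi_ag]. *)
Let satisfying h u :=
  tuple_values M (map (term_subst (all_some h)) (ag_tuple E)) u /\
  forall L, List.In L (ag_cond E) ->
    isat I (tau_lc M (lc_subst (all_some h) L)).

Let sub_tuple : {subset tuple_vars (ag_tuple E) <= ag_left_vars E}.
Proof. by move=> v vE; rewrite /ag_left_vars mem_cat vE. Qed.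

Let sub_cond L : List.In L (ag_cond E) ->
  {subset lc_vars L <= ag_left_vars E}.
Proof.
move=> LE v vL; rewrite /ag_left_vars mem_cat; apply/orP; right.
by apply/In_flatten_map; exists L.
Qed.

Let sub_left : {subset ag_left_vars E <= avoid}.
Proof. by move=> v vE; apply: avoidE; rewrite /ag_vars mem_cat vE. Qed.

Let eq_satisfying h k u : {in ag_left_vars E, h =1 k} ->
  satisfying h u -> satisfying k u.
Proof.
move=> hk [hu hC]; split.
  rewrite (@eq_map_term_subst _ _ (all_some h))// => v vE.
  by rewrite /all_some hk//; apply: sub_tuple.
move=> L LE; rewrite (@eq_lc_subst _ _ (all_some h)); first exact: hC.
by move=> v vL; rewrite /all_some hk//; apply: (sub_cond LE).
Qed.

(** The left side assigns values to the variables [XE] of the instance, the right side to [X], in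
    use the list of all local variables of the rule. Members of [X] outside [XE] do not occur in the
    left-hand part of [E], so their values are irrelevant. *)
Lemma delta_values_sat u :
  delta_values M [set r : (size XE).-tuple (pterm S) |
                   isat I (tau_cond M (E := E') r)]%classic u <->
  exists2 h, {in [predC X], e =1 h} & satisfying h u.
Proof.
(* Substituting [e] for the global variables and then [r] for the others amounts to evaluating at
   [h]: global variables lie outside [X], local ones survive into [XE]. *)
have agree h (r : (size XE).-tuple (pterm S)) : {in [predC X], e =1 h} ->
    {in X, forall v, v \in XE -> bind XE r v = Some (h v)} ->
    {in ag_left_vars E, then_subst (subst_on g e) (bind XE r) =1 all_some h}.
  move=> eh rh v vE; rewrite /then_subst /all_some.
  case: (boolP (g v)) (left_vars vE) => gv /= vX.
    by rewrite /subst_on gv eh// inE; apply/negP => /X_local; rewrite gv.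
  have ev : subst_on g e v = None by rewrite /subst_on (negPf gv).
  rewrite ev; apply: rh => //; rewrite mem_undup /ag_vars mem_cat.
  by rewrite ag_subst_left_vars.
have main h (r : (size XE).-tuple (pterm S)) : {in [predC X], e =1 h} ->
    {in X, forall v, v \in XE -> bind XE r v = Some (h v)} ->
    isat I (tau_cond M (E := E') r) /\
      tuple_values M (map (term_subst (bind XE r)) (ag_tuple E')) u
    <-> satisfying h u.
  move=> eh rh; have {rh}eh := agree h r eh rh.
  have -> : map (term_subst (bind XE r)) (ag_tuple E')
          = map (term_subst (all_some h)) (ag_tuple E).
    rewrite -[ag_tuple E']/(map (term_subst _) (ag_tuple E)).
    rewrite map_term_subst_comp; apply: eq_map_term_subst => v vE.
    by rewrite eh//; apply: sub_tuple.
  rewrite /tau_cond isat_IAnds_map.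
  suff -> : (forall L, List.In L (ag_cond E') ->
      isat I (tau_lc M (lc_subst (bind XE r) L))) <->
    forall L, List.In L (ag_cond E) ->
      isat I (tau_lc M (lc_subst (all_some h) L)) by rewrite /satisfying; tauto.
  have lcE L : List.In L (ag_cond E) ->
      lc_subst (bind XE r) (lc_subst (subst_on g e) L) = lc_subst (all_some h) L.
    move=> LE; rewrite lc_subst_comp; apply: eq_lc_subst => v vL.
    by rewrite eh//; apply: (sub_cond LE).
  split=> [H L LE|H L' /In_map[L LE ->]]; last by rewrite lcE//; apply: H.
  by rewrite -lcE//; apply: H; apply/In_map; exists L.
split=> [[r rsat ru]|[h eh hu]].
  (* Variables of [X] missing from [XE] receive the arbitrary value [PInf]. *)
  exists (fun v => if v \in X then odflt PInf (bind XE r v) else e v).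
    by move=> v /negPf; rewrite /= => ->.
  apply/(main _ r) => //.
    by move=> v /negPf; rewrite /= => ->.
  by move=> v vX vXE; rewrite vX /bind vXE.
have [|ru uu] := (main h [tuple of map h (in_tuple XE)] eh _).2 hu.
  move=> v vX vXE; rewrite /bind vXE /= (nth_map v) ?index_mem//.
  by rewrite nth_index.
by exists [tuple of map h (in_tuple XE)].
Qed.

(** The new variable [y] is forced to the single value of the bound. The set collected by the
    aggregate is the one in [delta_values_sat], so the comparison becomes the test made by
    [justifies]. *)
Lemma truth_phi_ag : truth M I e (phi_ag avoid X E) <-> isat I (tau_ag M E').
Proof.
rewrite isat_tau_ag /phi_ag.
set y := fresh avoid; set Z := freshs _ _; set F := FExs X _.
have y_avoid v : v \in avoid -> v != y.
  move=> va; apply/eqP => vy.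
  by have := fresh_notin avoid; rewrite -/y -vy va.
have Z_avoid v : v \in avoid -> v \notin Z.
  move=> va; apply/negP => /fresh_seq_notin.
  by rewrite inE va orbT.
(* A valuation [f] replaces [e] here because [y] is already rebound when the aggregate is
   evaluated. *)
have ZE f (u : seq (pterm S)) : {in avoid, f =1 e} ->
    (exists r : (size (ag_tl E)).+1.-tuple (pterm S),
      u = r /\ truth M I (upd f Z r) F) <->
    exists2 h, {in [predC X], e =1 h} & satisfying h u.
  move=> fe; have sZ : size Z = size (ag_tuple E) by rewrite size_tuple.
  have phiC k : truth M I k
      (FAnd (FIns Z (ag_tuple E))
         (FAnds (map (phi_lc (Z ++ y :: avoid)) (ag_cond E)))) <->
      satisfying k (map k Z).
    rewrite truth_and (truth_ins _ _ sZ) truth_ands /satisfying.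
    have lcP L : List.In L (ag_cond E) ->
        truth M I k (phi_lc (Z ++ y :: avoid) L) <->
        isat I (tau_lc M (lc_subst (all_some k) L)).
      move=> LE; apply: truth_phi_lc => v /(sub_cond LE)/sub_left va.
      by rewrite mem_cat inE va !orbT.
    by split=> -[kZ kC]; split=> // L LE; apply/lcP => //; apply: kC.
  split=> [[r [-> /truth_exs[k fk /phiC kZ]]]|[h eh hu]].
    have kr : map k Z = r.
      rewrite -[RHS](@map_upd f Z) ?uniq_freshs ?size_tuple//.
      apply/eq_in_map => v vZ; rewrite fk// inE.
      by apply: contraL vZ => /avoidX/Z_avoid.
    (* The witness keeps [k] on [X] only and forgets the rebinding of [Z] and [y], which do not
       occur in [E]. *)
    rewrite kr in kZ; exists (fun v => if v \in X then k v else e v).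
      by move=> v /negPf; rewrite /= => ->.
    apply: eq_satisfying kZ => v /sub_left va; case: ifPn => // vX.
    by rewrite -fk// upd_notin ?fe// Z_avoid.
  have su : size u == (size (ag_tl E)).+1.
    by rewrite (tuple_values_size hu.1) size_map.
  exists (Tuple su); split=> //; apply/truth_exs.
  (* Conversely, [Z] receives [u] and [X] the values of [h]; the two lists are disjoint, so neither
     update disturbs the other. *)
  exists (upd (upd f Z (Tuple su)) X (map h X)).
    by move=> v vX; rewrite [RHS]upd_notin.
  apply/phiC; set k := upd _ X _.
  have -> : map k Z = u.
    rewrite -[RHS](@map_upd f Z u) ?uniq_freshs//; last first.
      by rewrite size_tuple (eqP su).
    apply/eq_in_map => v vZ; rewrite /k upd_notin//.
    by apply: contraL vZ => /avoidX/Z_avoid.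
  apply: eq_satisfying hu => v /sub_left va.
  rewrite /k; case: (boolP (v \in X)) => vX; first by rewrite upd_map_in.
  by rewrite !upd_notin ?Z_avoid// fe// eh.
have aggE f : {in avoid, f =1 e} ->
    arg_val M I f (AAgg (ag_name E) (uniq_freshs _ _ : uniq Z) F)
    = agg_fun M (ag_name E) (delta_values M
        [set r : (size XE).-tuple (pterm S) |
          isat I (tau_cond M (E := E') r)]%classic).
  move=> fe /=; congr agg_fun; apply/funext => u; apply/propext.
  by rewrite delta_values_sat ZE.
(* A bound that is a variable is global, so the instance replaces it by a precomputed term, whose
   only value is itself. *)
have [s sE' sE] : exists2 s, ag_bound E' = inr s &
    forall f, {in avoid, f =1 e} ->
    values M (term_subst (all_some f) (bound_term (ag_bound E))) = [set s]%classic.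
  rewrite /E' /=; move: bound_global avoidE; rewrite /ag_vars.
  case: (ag_bound E) => [v|r] /= gE aE.
    exists (e v) => [|f fe]; first by rewrite /subst_on gE ?inE.
    rewrite values_emb fe//; apply: aE.
    by rewrite mem_cat inE eqxx orbT.
  by exists r => // f _; rewrite term_subst_emb values_emb.
have aggT f : {in avoid, f =1 e} ->
    truth M I f (FAnd (FCmp (ag_rel E)
        (AAgg (ag_name E) (uniq_freshs _ _ : uniq Z) F) (AVar y))
      (FIn (AVar y) (bound_term (ag_bound E)))) <->
    cmp_holds M (ag_rel E') (agg_fun M (ag_name E') (delta_values M
        [set r : (size XE).-tuple (pterm S) |
          isat I (tau_cond M (E := E') r)]%classic)) s /\ f y = s.
  move=> fe; rewrite truth_and -[ag_name E']/(ag_name E) -(aggE f)//.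
  rewrite [truth _ _ _ (FIn _ _)]/= -/(all_some f) sE//.
  by split=> -[H fs]; split=> //; move: H; rewrite /= fs.
rewrite /justifies sE' -[FEx _ _]/(FExs [:: y] _) truth_exs.
split=> [[f ef aggf]|jE].
  by case: (aggT f _).1 => // v /y_avoid vy; rewrite -ef// !inE.
have fe : {in avoid, upd e [:: y] [:: s] =1 e}.
  by move=> v /y_avoid vy; rewrite upd_notin// inE.
exists (upd e [:: y] [:: s]); first by move=> v vy; rewrite upd_notin.
by apply/aggT => //; rewrite upd1E eqxx.
Qed.

End PhiAg.

(** * Rule bodies, supporting instances and the completion *)

Definition instance e (R : rule S) : rule S :=
  rule_subst (subst_on (fun v => v \in global_vars R) e) R.

Definition body_holds I (R : rule S) : Prop :=
  isat I (IAnds (tau_conjunct M) (body R)).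

(** Every variable of a literal or comparison standing directly in the body is global, so there the
    partial substitution acts as [e] does. Aggregate expressions fall under [truth_phi_ag]. *)
Lemma truth_phi_body I e (avoid : seq (var S)) (R : rule S) :
  {subset rule_vars R <= avoid} ->
  truth M I e (phi_body avoid R) <-> body_holds I (instance e R).
Proof.
move=> avoidR; rewrite /phi_body truth_ands /body_holds isat_IAnds_map.
suff eqB B : List.In B (body R) ->
    truth M I e (phi_conjunct avoid (local_vars R) B) <->
    isat I (tau_conjunct M
      (conjunct_subst (subst_on (fun v => v \in global_vars R) e) B)).
  by split=> H B BR; apply/eqB => //; apply: H.
move=> BR; have BvarsR : {subset conjunct_vars B <= rule_vars R}.
  move=> v vB; rewrite /rule_vars mem_cat; apply/orP; right.
  by apply/In_flatten_map; exists B.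
have Bvars_avoid : {subset conjunct_vars B <= avoid}.
  by move=> v /BvarsR/avoidR.
have globalB v : v \in match B with
    | BLit L => lc_vars L
    | BAgg E => term_vars (bound_term (ag_bound E))
    end -> v \in global_vars R.
  move=> vB; rewrite /global_vars mem_cat; apply/orP; right.
  by apply/In_flatten_map; exists B.
case: B => [L|E] in BR BvarsR Bvars_avoid globalB *.
  rewrite [phi_conjunct _ _ _]/= truth_phi_lc//=.
  rewrite (@eq_lc_subst _ (subst_on _ _) (all_some e))// => v /globalB vR.
  by rewrite /subst_on vR.
apply: truth_phi_ag => // v.
- by rewrite mem_undup mem_filter => /andP[_ /avoidR].
- move=> vE; case: (boolP (v \in global_vars R)) => //= vR.
  by rewrite mem_undup mem_filter vR BvarsR//= /ag_vars mem_cat vE.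
- by rewrite mem_undup mem_filter => /andP[].
Qed.

Definition fires (H : sym S -> seq (term S) -> rhead S) I (R : rule S)
    (A : gatom S) : Prop :=
  exists2 ts, head R = H A.1 ts & tuple_values M ts A.2 /\ body_holds I R.

(** The extra conjunct [I A] for a choice rule comes from the head atom that its representation
    repeats in the antecedent. *)
Lemma truth_antecedent I e (V : seq (var S)) (R : rule S) pn :
  pn \in head_preds (head R) -> size V = pn.2 ->
  truth M I e (antecedent V R) <->
  let A := (pn.1, map e V) in
  fires (@HBasic S) I (instance e R) A \/
  fires (@HChoice S) I (instance e R) A /\ I A.
Proof.
move=> pnR sV; set A := (_, _); rewrite /antecedent.
have := @truth_phi_body I e (V ++ rule_vars R) R.
set B := phi_body _ _ => BP.
have {}BP : truth M I e B <-> body_holds I (instance e R).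
  by apply: BP => v vR; rewrite mem_cat vR orbT.
have eq_ts ts : {subset tuple_vars ts <= global_vars R} ->
    map (term_subst (subst_on (fun v => v \in global_vars R) e)) ts
    = map (term_subst (all_some e)) ts.
  by move=> tsR; apply: eq_map_term_subst => v /tsR vR; rewrite /subst_on vR.
have hR : {subset head_vars (head R) <= global_vars R}.
  by move=> v vR; rewrite /global_vars mem_cat vR.
have iR : head (instance e R) =
  head_subst (subst_on (fun v => v \in global_vars R) e) (head R) by [].
rewrite /fires iR; case: (head R) hR pnR => [p ts|p ts|] hR //.
- rewrite [head_preds _]/= inE => /eqP pnE.
  have sVt : size V = size ts by rewrite sV pnE.
  rewrite truth_and truth_ins// BP -eq_ts// /A pnE /=; split.
    by move=> [tsV BR]; left; eexists.
  by move=> [[us [<-]]|[[us []]]].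
- rewrite [head_preds _]/= inE => /eqP pnE.
  have sVt : size V = size ts by rewrite sV pnE.
  rewrite truth_ands3 truth_ins// BP -eq_ts// /A pnE /= -map_comp; split.
    by move=> [tsV [BR AI]]; right; split=> //; eexists.
  by move=> [[us []]|[[us [<-] []]]].
Qed.

(** The witness [f] may differ from [e] anywhere outside [V], because variables not free in [F] do
    not affect its truth. *)
Lemma truth_exs_fv I e (V : seq (var S)) F :
  truth M I e (FExs (undup [seq v <- fv F | v \notin V]) F) <->
  exists2 f, {in V, e =1 f} & truth M I f F.
Proof.
set U := undup _; rewrite truth_exs; split=> -[f ef Ff].
  exists f => // v vV; apply: ef.
  by rewrite inE mem_undup mem_filter vV.
exists (upd e U (map f U)); first by move=> v vU; rewrite upd_notin.
move: Ff; apply eq_truth => v vF.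
case: (boolP (v \in U)) => vU; first by rewrite upd_map_in.
rewrite upd_notin// ef//; apply: contraNT vU => vV.
by rewrite mem_undup mem_filter vV.
Qed.

Lemma truth_univ_closure I e F :
  truth M I e (univ_closure F) <-> forall f, truth M I f F.
Proof.
rewrite /univ_closure truth_alls; split=> [H f|H f _]; last exact: H.
have := H (upd e (undup (fv F)) (map f (undup (fv F)))).
rewrite (@eq_truth _ _ f); first by apply=> v vF; rewrite upd_notin.
by move=> v vF; rewrite upd_map_in// mem_undup.
Qed.

Lemma eq_instance e f (R : rule S) :
  {in rule_vars R, e =1 f} -> instance e R = instance f R.
Proof.
move=> ef; rewrite /instance; congr rule_subst; apply/funext => v.
rewrite /subst_on; case: ifPn => // vR; rewrite ef//.
move: vR; rewrite /global_vars /rule_vars !mem_cat => /orP[->//|].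
move=> /In_flatten_map[B BR vB]; apply/orP; right; apply/In_flatten_map.
exists B => //; case: B vB {BR} => //= E vE.
by rewrite /ag_vars mem_cat vE orbT.
Qed.

Lemma In_filter (T : Type) (P : pred T) (s : seq T) x :
  List.In x (filter P s) <-> List.In x s /\ P x.
Proof. exact: List.filter_In. Qed.

Definition program_instance (G : program S) : set (rule S) :=
  fun R' => exists2 R, G R & instance_of R R'.

Lemma head_preds_instance e (R : rule S) :
  head_preds (head (instance e R)) = head_preds (head R).
Proof. by case: R => -[p ts|p ts|] b //=; rewrite size_map. Qed.

Lemma fires_head_preds I (R : rule S) A :
  fires (@HBasic S) I R A \/ fires (@HChoice S) I R A ->
  (A.1, size A.2) \in head_preds (head R).
Proof.
by case=> -[ts -> [/tuple_values_size -> _]]; rewrite inE.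
Qed.

(** The new variables [V] occur in no rule, so the head arguments and the instance of the rule can
    be chosen independently. *)
Lemma truth_completed_definition I e (G : seq (rule S)) pn :
  truth M I e (completed_definition G pn) <->
  forall A : gatom S, (A.1, size A.2) = pn ->
    (I A <-> exists2 R, program_instance (prog G) R &
      fires (@HBasic S) I R A \/ fires (@HChoice S) I R A /\ I A).
Proof.
rewrite /completed_definition truth_alls; set V := freshs _ _.
have VG R : List.In R G -> {in rule_vars R, forall v, v \notin V}.
  move=> RG v vR; apply/negP => /fresh_seq_notin/negP; apply.
  by apply/In_flatten_map; exists R.
have sV : size V = pn.2 by rewrite size_tuple.
set D := FOrs _.
suff DP f : truth M I f D <-> exists2 R, program_instance (prog G) R &
    fires (@HBasic S) I R (pn.1, map f V) \/
    fires (@HChoice S) I R (pn.1, map f V) /\ I (pn.1, map f V).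
  split=> [H [p rs] /= pnE|H f _].
    have Vrs : map (upd e V rs) V = rs.
      by rewrite map_upd ?uniq_freshs// sV -pnE.
    have := H (upd e V rs); rewrite truth_iff DP Vrs /= -map_comp Vrs -pnE /=.
    by apply=> v vV; rewrite upd_notin.
  rewrite truth_iff DP /= -map_comp; apply: H => /=.
  by rewrite size_map sV -surjective_pairing.
rewrite truth_ors; split=> [[R /In_filter[RG pnR] /truth_exs_fv[k fk Rk]]|].
  have kV : map k V = map f V by apply/eq_in_map => v vV; rewrite fk.
  exists (instance k R); first by exists R => //; exists k.
  by have /(truth_antecedent _ _ pnR sV) := Rk; rewrite /= kV.
move=> [_ [R RG [e1 ->]]]; rewrite -/(instance e1 R) => fireR.
have pnR : pn \in head_preds (head R).
  rewrite -(head_preds_instance e1) [pn]surjective_pairing -sV -(size_map f).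
  by apply: (@fires_head_preds I _ (pn.1, map f V)); tauto.
exists R; first exact/In_filter.
(* This valuation agrees with [e1] on the variables of [R], which gives the same instance, and with
   [f] on [V]. *)
apply/truth_exs_fv; exists (upd e1 V (map f V)).
  by move=> v vV; rewrite upd_map_in.
apply/(truth_antecedent _ _ pnR sV) => /=.
rewrite map_upd ?uniq_freshs ?size_map//.
rewrite (@eq_instance _ e1)// => v /(VG _ RG) vV.
by rewrite upd_notin.
Qed.

(** Restates the completion over rule instances, so that the rest of the argument involves neither
    formulas nor valuations of variables. *)
Lemma satisfies_completion I (G : seq (rule S)) :
  satisfies M I (completion G) <->
  (forall A, vocabulary (prog G) A ->
     (I A <-> exists2 R, program_instance (prog G) R &
        fires (@HBasic S) I R A \/ fires (@HChoice S) I R A /\ I A)) /\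
  (forall R, program_instance (prog G) R -> head R = HNone ->
     ~ body_holds I R).
Proof.
have constraint R e : head R = HNone ->
    truth M I e (representation [::] R) <-> ~ body_holds I (instance e R).
  move=> RN; rewrite /representation /antecedent RN.
  by rewrite -(@truth_phi_body I e ([::] ++ rule_vars R)).
split=> [IG|[Idef Icon] F [[pn pnG ->]|[R [RG RN ->]]]].
- split=> [A AG|_ [R RG [e ->]]].
    have : completion G (completed_definition G (A.1, size A.2)).
      by left; exists (A.1, size A.2).
    by move=> /IG/truth_completed_definition; apply.
  rewrite -/(instance e R) => iRN.
  have RN : head R = HNone by case: R iRN {RG} => -[].
  apply/constraint => //.
  have : completion G (univ_closure (representation [::] R)).
    by right; exists R.
  by move=> /IG/truth_univ_closure; apply.
- apply/truth_completed_definition => A AE; apply: Idef.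
  by rewrite /vocabulary AE.
- apply/truth_univ_closure => e; apply/constraint => //.
  by apply: Icon; [exists R => //; exists e|rewrite /= RN].
Qed.

(** * Reducts *)

Lemma isat_imp I (G H : iform S) : isat I (IImp G H) -> isat I G -> isat I H.
Proof. by []. Qed.

Lemma reductT I (F : iform S) : isat I F ->
  reduct I F = match F with
               | IAtom A => IAtom A
               | IBot => IBot S
               | IAnd T H => IAnd (fun x => reduct I (H x))
               | IOr T H => IOr (fun x => reduct I (H x))
               | IImp G H => IImp (reduct I G) (reduct I H)
               end.
Proof. by case: F => * /=; rewrite asboolT. Qed.

Lemma reductF I (F : iform S) : ~ isat I F -> reduct I F = IBot S.
Proof. by case: F => * /=; rewrite asboolF. Qed.

(** A formula false in [I] has falsity as its reduct, which no [J] satisfies. *)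
Lemma isat_reduct J I (F : iform S) : isat J (reduct I F) -> isat I F.
Proof. by have [//|nF] := EM (isat I F); rewrite reductF. Qed.

Fixpoint all_atoms (P : gatom S -> Prop) (F : iform S) : Prop :=
  match F with
  | IAtom A => P A
  | IBot => True
  | IAnd _ H | IOr _ H => forall x, all_atoms P (H x)
  | IImp G H => all_atoms P G /\ all_atoms P H
  end.

(** For an implication, if [J] satisfies the reduct of the antecedent, then [I] satisfies the
    antecedent and hence the consequent, to which the induction hypothesis applies. *)
Lemma sat_reduct_agree J I (F : iform S) :
  all_atoms (fun A => I A -> J A) F -> isat I F -> isat J (reduct I F).
Proof.
elim: F => [A|//|T H IH|T H IH|G IHG H IHH] FJ FI; rewrite reductT//=.
- exact: FJ.
- by move=> x; apply: IH; [apply: FJ|apply: FI].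
- by case: FI => x Hx; exists x; apply: IH => //; apply: FJ.
- by move=> /isat_reduct/FI; apply: IHH; case: FJ.
Qed.

Lemma isat_reduct_self I (F : iform S) : isat I (reduct I F) <-> isat I F.
Proof.
split=> [/isat_reduct//|]; apply: sat_reduct_agree.
by elim: F => //= G IHG H IHH; split.
Qed.

(** Choice rules impose nothing on [I] itself, since their heads are instances of excluded
    middle. *)
Lemma isat_tau_rule I (R : rule S) : isat I (tau_rule M R) <->
  (forall A, fires (@HBasic S) I R A -> I A) /\
  (head R = HNone -> ~ body_holds I R).
Proof.
rewrite /tau_rule /fires /body_holds; case: (head R) => [p ts|p ts|] /=.
- split=> [H|[H _] BR [rs tsrs]]; last by apply: H; exists ts.
  split=> // -[q rs] [us [<- <-]] [tsrs /H]; exact: (fun h => h (exist _ rs tsrs)).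
- split=> [_|_ _ [rs tsrs]]; first by split=> // A [].
  have [Irs|nIrs] := EM (I (p, rs)); first by exists true.
  by exists false.
- by split=> [H|[_ H]]; [split=> // A []|apply: H].
Qed.

(* Only the rules firing A can tell I apart from I minus A. *)
Lemma reduct_tau_ruleD1 I A (R : rule S) : isat I (tau_rule M R) ->
  ~ (fires (@HBasic S) I R A \/ fires (@HChoice S) I R A) ->
  isat (fun B => I B /\ B <> A) (reduct I (tau_rule M R)).
Proof.
move=> IR nA; move: IR; rewrite /tau_rule.
have := @isat_reduct (fun B => I B /\ B <> A) I
  (IAnds (tau_conjunct M) (body R)).
rewrite /fires /body_holds in nA; move: nA; case: (head R) => [p ts|p ts|];
  move: (IAnds _ _) => B nA BI IR; rewrite (reductT IR) => /BI BIs;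
  have HI := isat_imp IR BIs; rewrite ?(reductT HI).
- move=> [rs tsrs]; have /= Irs := HI (exist _ rs tsrs).
  rewrite /= asboolT//; split=> // rsA; apply: nA; left.
  by exists ts; rewrite -rsA.
- move=> [rs tsrs]; rewrite /= asboolT; last exact: (HI (exist _ rs tsrs)).
  (* If the atom is not in [I], its negation reduces to an implication from falsity to falsity.
     Otherwise it differs from [A], because the rule does not fire [A], and so survives the
     removal. *)
  have [Ip|nIp] := EM (I (p, rs)); last first.
    by exists false; rewrite /= asboolT// asboolF.
  exists true; rewrite /= asboolT//; split=> // rsA; apply: nA; right.
  by exists ts; rewrite -rsA.
- by case: HI.
Qed.

(** For a choice rule, [I A] turns the negated disjunct into falsity in the reduct, so [J] can
    satisfy the head only by containing [A]. *)
Lemma reduct_fires J I A (R : rule S) :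
  fires (@HBasic S) I R A \/ fires (@HChoice S) I R A /\ I A ->
  isat I (tau_rule M R) -> isat J (reduct I (tau_rule M R)) ->
  isat J (reduct I (IAnds (tau_conjunct M) (body R))) -> J A.
Proof.
case: A => p rs [[ts /= hR [tsrs BR]]|[[ts /= hR [tsrs BR]] Irs]];
  rewrite /tau_rule hR => IR; rewrite (reductT IR) => JR {}/JR;
  have HI := isat_imp IR BR; rewrite (reductT HI).
  by move=> /(_ (exist _ rs tsrs)); rewrite reductT //; apply: (HI (exist _ rs tsrs)).
move=> /(_ (exist _ rs tsrs)); rewrite reductT; last exact: (HI (exist _ rs tsrs)).
by case=> -[]; rewrite /= ?(asboolT Irs)// asboolF// => /(_ Irs).
Qed.

Lemma dep_preds_instance e (R : rule S) :
  flatten (map (@dep_preds S) (body (instance e R)))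
  = flatten (map (@dep_preds S) (body R)).
Proof.
rewrite /= -map_comp; congr flatten; apply: eq_map => -[[p ts|p ts|//]|E] //=.
  by rewrite size_map.
rewrite /ag_preds /= -map_comp; congr flatten.
by apply: eq_map => -[p ts|p ts|] //= *; rewrite size_map.
Qed.

Lemma all_atoms_tau_lc (P : gatom S -> Prop) (L : lit_or_cmp S) :
  (forall A, (A.1, size A.2) \in lc_preds L -> P A) ->
  all_atoms P (tau_lc M L).
Proof.
case: L => [p ts|p ts|c t1 t2] /= PL; last by case: asboolP.
  by move=> [rs /= /tuple_values_size srs]; apply: PL; rewrite inE /= srs.
move=> [rs /= /tuple_values_size srs]; split=> //.
by apply: PL; rewrite inE /= srs.
Qed.

Lemma all_atoms_tau_ag (P : gatom S -> Prop) (E : aggexp S) :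
  (forall A, (A.1, size A.2) \in ag_preds E -> P A) ->
  all_atoms P (tau_ag M E).
Proof.
move=> PE.
have condP r : all_atoms P (tau_cond M (E := E) r).
  move=> i; apply: all_atoms_tau_lc => A.
  have /In_map[L LE ->] := In_tnth i.
  move=> AL; apply: PE; apply/In_flatten_map; exists L => //.
  by case: L AL {LE} => [p ts|p ts|] //=; rewrite size_map.
by move=> [D nD] /=; split=> -[r Dr]; apply: condP.
Qed.

(* Negative literals true in I remain true in every smaller J, so only the
   dependencies matter. *)
Lemma reduct_body J I (R : rule S) : (J `<=` I)%classic ->
  (forall A, (A.1, size A.2) \in flatten (map (@dep_preds S) (body R)) ->
     I A -> J A) ->
  body_holds I R -> isat J (reduct I (IAnds (tau_conjunct M) (body R))).
Proof.
move=> JI agree BR; rewrite reductT// => i.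
have Bi : isat I (tau_conjunct M (tnth (in_tuple (body R)) i)) by apply: BR.
move: (In_tnth i) Bi; move: (tnth _ _) => B BinR BI.
have {}agree A : (A.1, size A.2) \in dep_preds B -> I A -> J A.
  by move=> AB; apply: agree; apply/In_flatten_map; exists B.
case: B BI agree {BinR} => [[p ts|p ts|c t1 t2]|E] BI agree.
- by apply: sat_reduct_agree BI; apply: all_atoms_tau_lc.
- case: (BI) => -[rs tsrs] nI; rewrite reductT//; exists (exist _ rs tsrs).
  (* Satisfying the reduct of the negated atom would already put that atom in [I]. *)
  by rewrite reductT// => /isat_reduct/nI.
- by apply: sat_reduct_agree BI; apply: all_atoms_tau_lc.
- by apply: sat_reduct_agree BI; apply: all_atoms_tau_ag.
Qed.

End Semantics.

(** * Ranks from acyclicity, and the equivalence *)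

Lemma count_lt (T : eqType) (p q : pred T) (s : seq T) x :
  subpred p q -> x \in s -> q x -> ~~ p x -> count p s < count q s.
Proof.
move=> pq + qx npx; elim: s => //= y s IH; rewrite inE.
case/predU1P => [<-|/IH pqs]; first by rewrite (negPf npx) qx ltnS sub_count.
by rewrite -addnS leq_add//; case: (p y) (pq y) => // ->.
Qed.

(** The rank of [a] counts, with multiplicity, the symbols reachable from [a] in the finite list of
    all occurrences in the rules. Along an edge from [a] to [b], whatever [b] reaches is reached by
    [a] too, while [b] itself is lost: by tightness it does not reach itself. *)
Lemma tight_rank (S : signature) (G : seq (rule S)) : tight (prog G) ->
  exists rank : predsym S -> nat,
    forall a b, edge (prog G) a b -> rank b < rank a.
Proof.
move=> tG; pose reach a b := `[< clos_trans _ (edge (prog G)) a b >].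
exists (fun a => count (reach a) (flatten (map (@rule_preds S) G))) => a b ab.
apply: (@count_lt _ _ _ _ b).
- move=> c /asboolP bc; apply/asboolP.
  by apply: t_trans bc; apply: t_step.
- case: ab => R [RG _ /In_flatten_map[B BR bB]].
  apply/In_flatten_map; exists R => //; rewrite /rule_preds mem_cat.
  apply/orP; right; apply/In_flatten_map; exists B => //.
  by case: B bB {BR} => [[]|].
- by apply/asboolP; apply: t_step.
- by apply/asboolPn; apply: tG.
Qed.

Theorem theorem2 (S : signature) (M : semantics S) (Gamma : seq (rule S))
    (I : interpretation S) :
  tight (prog Gamma) ->
  (stable_model M (prog Gamma) I <->
   (I `<=` vocabulary (prog Gamma))%classic /\
   satisfies M I (completion Gamma)).
Proof.
move=> tG; rewrite satisfies_completion; split.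
  move=> [IG /isat_reduct IS Imin]; split=> //.
  have rule_sat R : program_instance (prog Gamma) R -> isat I (tau_rule M R).
    by move=> RG; apply: (IS (exist _ R RG)).
  split=> [A AG|R /rule_sat/isat_tau_rule[]//]; split=> [IA|]; last first.
    by move=> [R /rule_sat/isat_tau_rule[H _] [/H|[]]].
  apply: contrapT => unsupported.
  (* Minimality is applied to [I] without [A]: no instance supports [A], so its removal preserves
     the reduct of every rule. *)
  have : (fun B => I B /\ B <> A) = I.
    apply: Imin => [B [/IG//]|B []//|]; rewrite /tau reductT// => -[R RG] /=.
    apply: reduct_tau_ruleD1; first exact: rule_sat.
    by move=> RA; apply: unsupported; exists R => //; tauto.
  by move/(congr1 (fun K : interpretation S => K A)) => AE;
    move: IA; rewrite -AE => -[].
move=> [IG [Idef Icon]].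
have rule_sat R : program_instance (prog Gamma) R -> isat I (tau_rule M R).
  move=> RG; apply/isat_tau_rule; split=> [A AR|]; last exact: Icon.
  (* Completed definitions cover only atoms of the vocabulary; [A] is one, its predicate symbol
     being that of a rule head. *)
  apply/Idef; last by exists R => //; left.
  case: RG AR => R0 R0G [e ->]; rewrite -/(instance e R0) => AR.
  exists R0; split=> //; rewrite /rule_preds mem_cat -(head_preds_instance e).
  by rewrite (fires_head_preds (or_introl AR)).
have IS : isat I (tau M (prog Gamma)) by move=> [R RG]; apply: rule_sat.
split=> //; first exact/isat_reduct_self.
move=> J JG JI; rewrite /tau reductT// => JS.
have [rank rankP] := tight_rank tG.
(* The bound [n] turns induction on numbers into strong induction on the rank. *)
suff IJ n A : rank (A.1, size A.2) < n -> I A -> J A.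
  by apply/seteqP; split=> // A; apply: IJ (ltnSn _).
elim: n A => // n IH A An IA.
have [R RG AR] := (Idef A (IG A IA)).1 IA.
apply: (reduct_fires AR); [exact: rule_sat|exact: (JS (exist _ R RG))|].
apply: reduct_body => //; last by case: AR => [[ts _ []]|[[ts _ []]]].
(* Passing to an instance changes no predicate symbol, so each dependency of the body is the target
   of an edge from the symbol of [A] and has smaller rank. *)
case: RG AR => R0 R0G [e ->]; rewrite -/(instance e R0) => AR B.
rewrite dep_preds_instance => BR; apply: IH.
suff /leq_trans-> : rank (B.1, size B.2) < rank (A.1, size A.2) by [].
apply: rankP; exists R0; split=> //; rewrite -(head_preds_instance e).
by apply: (@fires_head_preds _ M I); tauto.
Qed.
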